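(* Suppose that $k>1$ and $I$ is a $k$-subset of $\{1,\dots,n\}$. Then applying the twist $f\mapsto\overleftarrow{f}$ to $[I]\in\mathbb{C}[\mathrm{Gr}_{k,n}]$ successively $2n$ times gives $[I]$ multiplied by a monomial in the Plücker coordinates $[\mathbf{i}]$, $i\in\{1,\dots,n\}$.
   Context: Let $k\le n$ be positive integers. $M_{k,n}$ is the set of complex $k\times n$ matrices $p$ with columns $p_1,\dots,p_n$. For a $k$-subset $I$ of $\{1,\dots,n\}$, $[I]$ (Plücker coordinate) is the function sending a matrix to its $k\times k$ minor with column set $I$ in increasing order. The homogeneous coordinate ring $\mathbb{C}[\mathrm{Gr}_{k,n}]$ is the subalgebra of $\mathbb{C}[M_{k,n}]$ generated by all $[I]$. Let $\sigma(i)=i-1$ reduced modulo $n$ into $\{1,\dots,n\}$, and $\mathbf{i}=\{\sigma^{k-1}(i),\dots,\sigma(i),i\}$ for $1\le i\le n$. For $v_1,\dots,v_{k-1}\in\mathbb{C}^k$, $v_1\times\cdots\times v_{k-1}$ is the unique vector with $(v_1\times\cdots\times v_{k-1})^Tv=\det(v_1,\dots,v_{k-1},v)$ for all $v\in\mathbb{C}^k$. The twist $\overleftarrow{p}\in M_{k,n}$ of $p\in M_{k,n}$ has $i$th column $\varepsilon_i\, p_{\sigma^{k-1}(i)}\times p_{\sigma^{k-2}(i)}\times\cdots\times p_{\sigma(i)}$, where $\varepsilon_i=(-1)^{i(k-i)}$ if $i\le k-1$ and $\varepsilon_i=1$ if $i\ge k$. For $f\in\mathbb{C}[\mathrm{Gr}_{k,n}]$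 its twist is $\overleftarrow{f}(p)=f(\overleftarrow{p})$; this defines an algebra endomorphism of $\mathbb{C}[\mathrm{Gr}_{k,n}]$. *)

(* Defs.v *)
From HB Require Import structures.
From mathcomp Require Import all_boot all_order all_algebra perm.
From mathcomp Require Import boolp functions.
From mathcomp Require Import zify.

Set Implicit Arguments.
Unset Strict Implicit.
Unset Printing Implicit Defensive.

Import GRing.Theory.
Local Open Scope ring_scope.

(* Indices are 0-based: the column i of {1, ..., n} is the ordinal i.-1 of
   'I_n.  Thus sigma is [ord_pred], the cyclic predecessor on 'I_n. *)

Section KSubsets.
Variables k n : nat.

Definition k_subset := {I : {set 'I_n} | #|I| == k}.

(* [enum_val] lists the elements of I in increasing order (see
   [ksub_col_lt]). *)
Definition ksub_col (I : k_subset) (j : 'I_k) : 'I_n :=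
  enum_val (cast_ord (esym (eqP (valP I))) j).

Lemma ksub_col_lt (I : k_subset) (i j : 'I_k) :
  (i < j)%N -> (ksub_col I i < ksub_col I j)%N.
Proof.
move=> ij; have i0 : 'I_n := ksub_col I i.
rewrite /ksub_col !(enum_val_nth i0) /=.
have sE : sorted ltn (map val (enum (sval I))).
  apply: (subseq_sorted ltn_trans (s2 := map val (enum 'I_n))).
    apply: map_subseq; rewrite {1}/enum_mem -enumT.
    exact: filter_subseq.
  by rewrite val_enum_ord iota_ltn_sorted.
have sz : size (enum (sval I)) = k by rewrite -cardE (eqP (valP I)).
have := sorted_ltn_nth ltn_trans (val i0) sE.
move=> /(_ i j); rewrite !inE size_map sz !ltn_ord => /(_ isT isT ij).
by rewrite !(nth_map i0) ?sz.
Qed.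

Definition frozen_set (i : 'I_n) : {set 'I_n} :=
  [set iter m (@ord_pred n) i | m : 'I_k].

Lemma iter_ord_predE (i : 'I_n) m : (m <= n)%N ->
  iter m (@ord_pred n) i = ((i + (n - m)) %% n)%N :> nat.
Proof.
elim: m => [|m IHm] mn /=; first by rewrite subn0 modnDr modn_small.
rewrite IHm ?(ltnW mn) //.
have n0 : (0 < n)%N by exact: leq_ltn_trans mn.
have -> x : ((x + n).-1 = x + n.-1)%N by lia.
rewrite modnDml.
have -> : (i + (n - m) + n.-1 = i + (n - m.+1) + n)%N by lia.
by rewrite modnDr.
Qed.

Lemma card_frozen_set (i : 'I_n) : (k <= n)%N -> #|frozen_set i| == k.
Proof.
move=> kn; rewrite card_imset ?card_ord // => m m' /(congr1 val) /=.
have hm := ltn_ord m; have hm' := ltn_ord m'; have hi := ltn_ord i.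
rewrite !iter_ord_predE; [|lia|lia] => /eqP.
rewrite eqn_modDl => /eqP e; apply: val_inj => /=.
case: (posnP m) (posnP m') => [m0 [m'0|m'0]|m0 [m'0|m'0]].
- by rewrite m0 m'0.
- by move: e; rewrite m0 subn0 modnn modn_small; lia.
- by move: e; rewrite m'0 subn0 modnn modn_small; lia.
- by move: e; rewrite !modn_small; lia.
Qed.

Definition frozen (kn : (k <= n)%N) (i : 'I_n) : k_subset :=
  exist _ (frozen_set i) (card_frozen_set i kn).

End KSubsets.

Section CrossProduct.
Variable F : fieldType.

(* The square matrix (v_1, ..., v_{k-1}, w), the v_j being the columns of V. *)
Definition bordered k (V : 'M[F]_(k, k.-1)) (w : 'cV[F]_k) : 'M[F]_k :=
  \matrix_(a, b) if insub (b : nat) is Some j then V a j else w a 0.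

Definition cross k (V : 'M[F]_(k, k.-1)) : 'cV[F]_k :=
  \col_a \det (bordered V (delta_mx a 0)).

Lemma borderedS k (V : 'M[F]_(k.+1, k)) w (a b : 'I_k.+1) :
  bordered V w a b = if unlift ord_max b is Some j then V a j else w a 0.
Proof.
rewrite mxE; case: unliftP => [j ->|->]; last by rewrite insubF //= ltnn.
case: insubP => [j' _ e|]; last by rewrite lift_max ltn_ord.
by congr (V _ _); apply: val_inj; rewrite e lift_max.
Qed.

Lemma bordered_lift k (V : 'M[F]_(k.+1, k)) w a j :
  bordered V w a (lift ord_max j) = V a j.
Proof. by rewrite borderedS liftK. Qed.

Lemma bordered_max k (V : 'M[F]_(k.+1, k)) w a :
  bordered V w a ord_max = w a 0.
Proof. by rewrite borderedS unlift_none. Qed.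

Lemma crossP k (V : 'M[F]_(k, k.-1)) (w : 'cV[F]_k) : (0 < k)%N ->
  (cross V)^T *m w = (\det (bordered V w))%:M.
Proof.
case: k V w => // k V w _; apply/matrixP => i j; rewrite !ord1 !mxE eqxx mulr1n.
have cofE (u : 'cV_k.+1) a : cofactor (bordered V u) a ord_max
    = cofactor (bordered V 0) a ord_max.
  congr (_ * \det _); apply/matrixP => x y.
  by rewrite 2![LHS]mxE 2![RHS]mxE !bordered_lift.
rewrite (expand_det_col _ ord_max); apply: eq_bigr => a _.
rewrite bordered_max cofE mulrC !mxE; congr (_ * _).
rewrite (expand_det_col _ ord_max) (bigD1 a) //= bordered_max cofE mxE !eqxx.
rewrite mul1r big1 ?addr0 // => b ba.
by rewrite bordered_max mxE (negPf ba) mul0r.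
Qed.

Lemma cross_unique k (V : 'M[F]_(k, k.-1)) (x : 'cV[F]_k) : (0 < k)%N ->
  (forall w, x^T *m w = (\det (bordered V w))%:M) -> x = cross V.
Proof.
move=> k0 xP; apply: trmx_inj; apply/row_matrixP => i; rewrite ord1.
apply/rowP => j; have := xP (delta_mx j 0); rewrite -crossP //.
by rewrite -!colE => /matrixP /(_ 0 0); rewrite !mxE.
Qed.

Lemma det_bordered_cross k (Y V : 'M[F]_(k.+1, k)) :
  \det (bordered Y (cross (V : 'M_(k.+1, k.+1.-1)))) = \det (Y^T *m V).
Proof.
set X := bordered Y _.
have key u : \det X * \det (bordered V u)
           = \det (Y^T *m V) * \det (bordered V u).
  rewrite -[in LHS]det_tr -det_mulmx (expand_det_row _ ord_max).
  rewrite (bigD1 ord_max) //= big1 ?addr0; last first.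
    move=> b; case: (unliftP ord_max b) => [j ->|-> /eqP//] _.
    set B := X^T *m _; suff -> : B ord_max (lift ord_max j) = 0 by rewrite mul0r.
    have -> : B ord_max (lift ord_max j) = ((cross V)^T *m col j V) 0 0.
      rewrite !mxE; apply: eq_bigr => a _.
      by rewrite mxE bordered_max bordered_lift !mxE.
    rewrite (@crossP k.+1) // mxE eqxx mulr1n -det_tr.
    apply: (@determinant_alternate _ _ _ (lift ord_max j) ord_max).
      by rewrite eq_sym neq_lift.
    by move=> a; rewrite [LHS]mxE [RHS]mxE bordered_lift bordered_max mxE.
  set B := X^T *m _.
  have -> : B ord_max ord_max = \det (bordered V u).
    transitivity (((cross V)^T *m u) 0 0).
      rewrite !mxE; apply: eq_bigr => a _.
      by rewrite mxE !bordered_max !mxE.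
    by rewrite (@crossP k.+1) // mxE eqxx mulr1n.
  rewrite mulrC; congr (_ * _).
  rewrite /cofactor /= addnn -signr_odd odd_double mul1r; congr (\det _).
  apply/matrixP => i j; rewrite !mxE; apply: eq_bigr => a _.
  by rewrite mxE !bordered_lift mxE.
have [YV0|YV0] := eqVneq (\det (Y^T *m V)) 0; last first.
  have : \rank (kermx Y) != 0%N.
    by rewrite mxrank_ker; have := rank_leq_col Y; lia.
  rewrite mxrank_eq0 => /rowV0Pn[u /sub_kermxP uY u0].
  have := key u^T; set D := \det (bordered _ _) => keyu.
  suff D0 : D != 0 by apply: (mulIf D0).
  apply: contra u0; rewrite /D -det_tr => /det0P[v v0 vB].
  pose c : 'rV_k := \row_j v 0 (lift ord_max j).
  have vE : v *m (bordered V u^T)^T = c *m V^T + v 0 ord_max *: u.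
    apply/rowP => a; rewrite [LHS]mxE (bigD1_ord ord_max) //= [RHS]mxE addrC.
    congr (_ + _); last first.
      by rewrite [RHS]mxE; congr (_ * _); rewrite mxE bordered_max mxE.
    rewrite mxE; apply: eq_bigr => j _.
    by rewrite [in RHS]mxE; congr (_ * _); rewrite mxE bordered_lift mxE.
  have c0 : c = 0.
    have : c *m (V^T *m Y) = 0.
      have := congr1 (mulmx^~ Y) vE.
      by rewrite /= vB mul0mx mulmxDl -scalemxAl uY scaler0 addr0 -mulmxA.
    have YVu : V^T *m Y \in unitmx.
      by rewrite unitmxE unitfE -det_tr trmx_mul trmxK.
    by move=> /(congr1 (mulmx^~ (invmx (V^T *m Y)))); rewrite mulmxK // mul0mx.
  move: vB; rewrite vE c0 mul0mx add0r => /eqP; rewrite scaler_eq0.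
  case/orP=> // /eqP vm0; case/negP: v0; apply/eqP/rowP => j; rewrite mxE.
  case: (unliftP ord_max j) => [j' ->|-> //].
  by have /rowP/(_ j') := c0; rewrite !mxE.
rewrite YV0; apply/eqP; apply: contraT => X0; case/negP: (X0); apply/eqP.
have V0 : cross (V : 'M_(k.+1, k.+1.-1)) = 0.
  apply/colP => a; rewrite !mxE; have /eqP := key (delta_mx a 0).
  by rewrite YV0 mul0r mulf_eq0 (negPf X0) => /eqP.
rewrite (expand_det_col _ ord_max) big1 // => a _.
by rewrite bordered_max V0 mxE mul0r.
Qed.

End CrossProduct.

Section CoordinateRing.
Variables (F : fieldType) (k n : nat).

Definition plucker_fun (I : k_subset k n) : 'M[F]_(k, n) -> F :=
  fun p => \det (colsub (ksub_col I) p).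

Inductive in_Gr : ('M[F]_(k, n) -> F) -> Prop :=
| in_Gr_plucker I : in_Gr (plucker_fun I)
| in_Gr_cst c : in_Gr (fun=> c)
| in_Gr_add f g : in_Gr f -> in_Gr g -> in_Gr (fun p => f p + g p)
| in_Gr_mul f g : in_Gr f -> in_Gr g -> in_Gr (fun p => f p * g p).

Definition Gr_pred : {pred 'M[F]_(k, n) -> F} := fun f => `[< in_Gr f >].

Lemma Gr_predP f : reflect (in_Gr f) (f \in Gr_pred).
Proof. exact: asboolP. Qed.

Lemma Gr_subring : subring_closed Gr_pred.
Proof.
split=> [|f g /Gr_predP fG /Gr_predP gG|f g /Gr_predP fG /Gr_predP gG];
  apply/Gr_predP; [exact: in_Gr_cst | | exact: in_Gr_mul].
suff -> : f - g = (fun p => f p + (-1) * g p).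
  by apply: in_Gr_add => //; apply: in_Gr_mul => //; exact: in_Gr_cst.
by apply/funext => p; rewrite mulN1r.
Qed.
HB.instance Definition _ := GRing.isSubringClosed.Build _ Gr_pred Gr_subring.

(* F[Gr_{k,n}]: the F-subalgebra generated by the Pluecker coordinates, inside
   the functions on M_{k,n}.  For F infinite, as is C, the polynomial ring
   F[M_{k,n}] embeds in these functions. *)
Record Gr_ring := MkGr {
  Gr_fun :> 'M[F]_(k, n) -> F;
  Gr_funP : Gr_fun \in Gr_pred }.
HB.instance Definition _ := [isSub for Gr_fun].
HB.instance Definition _ := [Choice of Gr_ring by <:].
HB.instance Definition _ :=
  GRing.SubChoice_isSubComPzRing.Build _ _ Gr_ring Gr_subring.

Definition plucker (I : k_subset k n) : Gr_ring :=
  @MkGr (plucker_fun I) (introT (Gr_predP _) (in_Gr_plucker I)).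

Lemma in_Gr_sum (T : Type) (r : seq T) (f : T -> 'M[F]_(k, n) -> F) :
  (forall i, in_Gr (f i)) -> in_Gr (fun p => \sum_(i <- r) f i p).
Proof.
move=> fG; suff -> : (fun p => \sum_(i <- r) f i p) = \sum_(i <- r) f i.
  by apply/Gr_predP/rpred_sum => i _; apply/Gr_predP.
by rewrite fct_sumE.
Qed.

Lemma in_Gr_prod (T : Type) (r : seq T) (f : T -> 'M[F]_(k, n) -> F) :
  (forall i, in_Gr (f i)) -> in_Gr (fun p => \prod_(i <- r) f i p).
Proof.
move=> fG; suff -> : (fun p => \prod_(i <- r) f i p) = \prod_(i <- r) f i.
  by apply/Gr_predP/rpred_prod => i _; apply/Gr_predP.
by rewrite fct_prodE.
Qed.

Lemma in_Gr_det m (A : 'M[F]_(k, n) -> 'M[F]_m) :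
  (forall i j, in_Gr (fun p => A p i j)) -> in_Gr (fun p => \det (A p)).
Proof.
move=> AG; apply: in_Gr_sum => s; apply: in_Gr_mul; first exact: in_Gr_cst.
exact: in_Gr_prod.
Qed.

Lemma in_Gr_colsub (f : 'I_k -> 'I_n) :
  in_Gr (fun p => \det (colsub f p)).
Proof.
have [/injectiveP f_inj|/injectivePn[x [y xy fxy]]] := boolP (injectiveb f);
  last first.
  rewrite (_ : (fun _ => _) = fun=> 0); first exact: in_Gr_cst.
  apply/funext => p; rewrite -det_tr (determinant_alternate xy) // => a.
  by rewrite !mxE fxy.
have cI : #|[set f j | j : 'I_k]| == k by rewrite card_imset // card_ord.
pose I : k_subset k n := exist (fun I : {set 'I_n} => #|I| == k) _ cI.
have fI j : f j \in sval I by exact: imset_f.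
pose s0 j := cast_ord (eqP cI) (enum_rank_in (fI j) (f j)).
have s0K j : ksub_col I (s0 j) = f j.
  rewrite /ksub_col /s0 -[RHS](enum_rankK_in (fI j) (fI j)).
  by congr enum_val; apply: val_inj.
have s0_inj : injective s0.
  by move=> i j /(congr1 (ksub_col I)); rewrite !s0K => /f_inj.
rewrite (_ : (fun _ => _) = fun p => plucker_fun I p * (-1) ^+ perm s0_inj).
  by apply: in_Gr_mul; [exact: in_Gr_plucker|exact: in_Gr_cst].
apply/funext => p; rewrite /plucker_fun.
have -> : colsub f p = col_perm (perm s0_inj) (colsub (ksub_col I) p).
  by apply/matrixP => a b; rewrite !mxE permE s0K.
by rewrite col_permE det_mulmx det_perm odd_permV.
Qed.

End CoordinateRing.

Section Twist.
Variables (F : fieldType) (k n : nat).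

(* [i] being 0-based, it stands for the column i.+1. *)
Definition twist_sign (i : 'I_n) : F :=
  if (i.+1 < k)%N then (-1) ^+ (i.+1 * (k - i.+1)) else 1.

(* The columns p_{sigma^{k-1}(i)}, ..., p_{sigma(i)}. *)
Definition twist_cols (p : 'M[F]_(k, n)) (i : 'I_n) : 'M[F]_(k, k.-1) :=
  colsub (fun j : 'I_k.-1 => iter (k.-1 - j) (@ord_pred n) i) p.

Definition twist_mx (p : 'M[F]_(k, n)) : 'M[F]_(k, n) :=
  \matrix_(a, i) (twist_sign i * cross (twist_cols p i) a 0).

End Twist.

Section TwistGr.
Variable F : fieldType.

Lemma in_Gr_cross k n (e : 'I_k -> F) (J : 'I_k -> 'I_k.-1 -> 'I_n) :
  in_Gr (fun p : 'M[F]_(k, n) =>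
    \det (\matrix_(a, b) (e b * cross (colsub (J b) p) a 0))).
Proof.
case: k e J => [|k] e J.
  rewrite (_ : (fun _ => _) = fun=> 1); first exact: in_Gr_cst.
  by apply/funext => p; rewrite det_mx00.
pose J' (p : 'M[F]_(k.+1, n)) :=
  \matrix_(a < k.+1, j < k) cross (colsub (J (lift ord_max j)) p) a 0.
pose V p := colsub (J ord_max) p : 'M[F]_(k.+1, k).
rewrite (_ : (fun _ => _) = fun p => (\prod_b e b) * \det ((J' p)^T *m V p)).
  apply: in_Gr_mul; first exact: in_Gr_cst.
  apply: in_Gr_det => i j.
  pose f b := if unlift ord_max b is Some c then J (lift ord_max i) c
              else J ord_max j.
  rewrite (_ : (fun _ => _) = fun p => \det (colsub f p)).
    exact: in_Gr_colsub.
  apply/funext => p.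
  transitivity (((cross (colsub (J (lift ord_max i)) p))^T *m col j (V p)) 0 0).
    by rewrite !mxE; apply: eq_bigr => a _; rewrite !mxE.
  rewrite crossP // mxE eqxx mulr1n; congr (\det _); apply/matrixP => a b.
  by rewrite borderedS [RHS]mxE /f; case: unliftP => [c _|_]; rewrite !mxE.
apply/funext => p; rewrite -det_bordered_cross.
transitivity (\det (diag_mx (\row_b e b)) *
  \det (bordered (J' p) (cross (V p : 'M_(k.+1, k.+1.-1))))).
  rewrite mulrC -det_mulmx; congr (\det _); apply/matrixP => a b.
  rewrite mul_mx_diag [LHS]mxE [RHS]mxE borderedS [X in _ = _ * X]mxE mulrC.
  congr (_ * _); case: unliftP => [j ->|->]; last by [].
  by rewrite [RHS]mxE.
by rewrite det_diag; congr (_ * _); apply: eq_bigr => b _; rewrite mxE.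
Qed.

Variables k n : nat.

Lemma in_Gr_twist (f : 'M[F]_(k, n) -> F) :
  in_Gr f -> in_Gr (fun p => f (twist_mx p)).
Proof.
elim=> [I|c|g h _ gG _ hG|g h _ gG _ hG].
- rewrite (_ : (fun _ => _) = fun p => \det (\matrix_(a, b)
    (twist_sign F k (ksub_col I b) *
     cross (colsub ((fun b (j : 'I_k.-1) =>
       iter (k.-1 - j) (@ord_pred n) (ksub_col I b)) b) p) a 0))).
    exact: in_Gr_cross.
  apply/funext => p; congr (\det _); apply/matrixP => a b.
  by rewrite 2![LHS]mxE [RHS]mxE.
- exact: in_Gr_cst.
- exact: in_Gr_add.
- exact: in_Gr_mul.
Qed.

Definition twist (f : Gr_ring F k n) : Gr_ring F k n :=
  @MkGr F k n (fun p => f (twist_mx p))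
    (introT (Gr_predP _) (in_Gr_twist (elimT (Gr_predP _) (Gr_funP f)))).

Lemma twist_is_zmod_morphism : zmod_morphism twist.
Proof. by move=> f g; apply: val_inj. Qed.
HB.instance Definition _ :=
  GRing.isZmodMorphism.Build _ _ twist twist_is_zmod_morphism.

Lemma twist_is_monoid_morphism : monoid_morphism twist.
Proof. by split=> [|f g]; apply: val_inj. Qed.
HB.instance Definition _ :=
  GRing.isMonoidMorphism.Build _ _ twist twist_is_monoid_morphism.

End TwistGr.

(* Main.v *)
Require Import Defs.
From mathcomp Require Import all_boot all_order all_algebra perm.
From mathcomp Require Import zify ring boolp functions.
From mathcomp Require Import reals complex.

(** The columns of p are extended to an infinite sequence P with
    P (i + n) = eta P i, where eta = (-1)^(k-1) and k is the number of rows
    (which is k.+1 or k.+2 in the lemmas).  The signs epsilon_i of the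
    twist are exactly what this extension needs: the extension W of the
    twisted matrix satisfies W (s + k - 1) = P s x ... x P (s + k - 2) for every
    s, with no sign left ([cyclic_col_twist]).  In the same way
    D s = det (P s, ..., P (s + k - 1)) is always a frozen Pluecker coordinate,
    never its opposite ([plucker_frozen]).

    Twist twice.  The k - 1 cross products W (s + k - 1), ..., W (s + 2k - 3)
    are all orthogonal to P (s + k - 2), so their cross product is a multiple of
    this vector.  The factor comes from multiplying the matrix
    (W (s + k - 1), ..., W (s + 2k - 3), y), transposed, by
    (P (s + k - 2), ..., P (s + 2k - 3)): the product is triangular up to the
    position of its first column, so that, when D (s + k - 2) is nonzero, the
    factor is eta D s ... D (s + k - 3) ([cross_cross]).

    Hence on the matrices with no zero frozen coordinate, which form a set
    stable under the double twist, column t + k of the double twist of p is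
    column t of p times eta and a monomial in the frozen coordinates; these
    monomials are carried to monomials by the double twist.  After n double
    twists the column t has come round to t + nk, that is to itself, with the
    sign eta^k = 1; the sign eta^n left on every column disappears from k x k
    minors ([plucker_iter_double_twist]).

    Finally an identity between elements of the coordinate ring which holds
    where no frozen coordinate vanishes holds everywhere: restrict both sides to
    the line through p and a matrix all of whose maximal minors are nonzero,
    such as a Vandermonde matrix, and compare two polynomials in one variable
    ([in_Gr_dense]). *)

Set Implicit Arguments.
Unset Strict Implicit.
Unset Printing Implicit Defensive.

Import GRing.Theory.
Local Open Scope ring_scope.

(** * Minors and cross products of consecutive vectors of a sequence *)

Section Sequences.
Variables (F : fieldType) (k : nat).
Implicit Type P : nat -> 'cV[F]_k.+1.

Definition quasi_periodic m P := forall i, P (i + m)%N = (-1) ^+ k *: P i.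

Definition window m s P : 'M[F]_(k.+1, m) := \matrix_(a, j) P (s + j)%N a 0.

Lemma quasi_periodic_mul m P i q : quasi_periodic m P ->
  P (i + q * m)%N = (-1) ^+ (k * q) *: P i.
Proof.
move=> Pm; elim: q => [|q IHq]; first by rewrite mul0n addn0 muln0 scale1r.
by rewrite mulSnr addnA Pm IHq scalerA mulnS exprD.
Qed.

Lemma signr_mul_pred : (-1) ^+ (k * k.+1) = 1 :> F.
Proof. by rewrite -signr_odd oddM /= andbN. Qed.

Lemma det_scale_cols m (c : 'I_m -> F) (A B : 'M[F]_m) :
  (forall a j, A a j = c j * B a j) -> \det A = \prod_j c j * \det B.
Proof.
move=> AB; rewrite mulrC; have -> : A = B *m diag_mx (\row_j c j).
  by apply/matrixP => a j; rewrite mul_mx_diag AB [RHS]mxE mxE mulrC.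
rewrite det_mulmx det_diag; congr (_ * _).
by apply: eq_bigr => j _; rewrite mxE.
Qed.

(** The two matrices have the same minors along their column which moves; only
    its position, hence the sign of its cofactors, differs. *)
Lemma det_rotate_cols (A B : 'M[F]_k.+1) :
    (forall a j, B a (lift ord_max j) = A a (lift ord0 j)) ->
    (forall a, B a ord_max = A a ord0) ->
  \det B = (-1) ^+ k * \det A.
Proof.
move=> BA BA0; rewrite (expand_det_col _ ord_max) (expand_det_col A ord0).
rewrite mulr_sumr; apply: eq_bigr => a _; rewrite BA0 [RHS]mulrCA.
congr (_ * _); rewrite /cofactor /= addn0 addnC exprD mulrA; congr (_ * \det _).
by apply/matrixP => x y; rewrite 2![LHS]mxE 2![RHS]mxE BA.
Qed.

(** One step of the window is a cyclic rotation of its columns, of sign (-1)^k;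
    the sign in the periodicity undoes it. *)
Lemma det_window_shift P s : quasi_periodic k.+1 P ->
  \det (window k.+1 s P) = \det (window k.+1 0 P).
Proof.
move=> Pk; elim: s => // s <-.
pose c (j : 'I_k.+1) : F := if j == ord_max then (-1) ^+ k else 1.
pose A := \matrix_(a, j < k.+1) P (s + (j.+1 %% k.+1))%N a 0.
rewrite (det_scale_cols (c := c) (B := A)); last first.
  move=> a j; rewrite !mxE /c; case: eqP => [->|/eqP jm] /=.
    by rewrite modnn addn0 addSnnS Pk mxE.
  rewrite modn_small ?mul1r ?addSnnS //.
  by move: jm; rewrite -val_eqE /=; have := ltn_ord j; lia.
rewrite (bigD1 ord_max) //= big1 => [|j jm]; last by rewrite /c (negPf jm).
rewrite /c eqxx mulr1 (det_rotate_cols (A := window k.+1 s P)) => [|a j|a].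
- by rewrite mulrA -expr2 sqrr_sign mul1r.
- by rewrite !mxE lift_max lift0 modn_small // ltnS ltn_ord.
- by rewrite !mxE /= modnn.
Qed.

Lemma det_bordered_window P s :
  \det (bordered (window k s P) (P (s + k)%N)) = \det (window k.+1 s P).
Proof.
congr (\det _); apply/matrixP => a b; rewrite borderedS [RHS]mxE.
by case: unliftP => [j ->|-> //]; rewrite mxE lift_max.
Qed.

Lemma det_bordered_window_eq0 P s c : (c < k)%N ->
  \det (bordered (window k s P) (P (s + c)%N)) = 0.
Proof.
move=> ck; rewrite -det_tr.
apply: (@determinant_alternate _ _ _ (lift ord_max (Ordinal ck)) ord_max).
  by rewrite eq_sym neq_lift.
by move=> a; rewrite [LHS]mxE [RHS]mxE bordered_lift bordered_max mxE.
Qed.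

Lemma cross_scale_cols (c : 'I_k -> F) (U V : 'M[F]_(k.+1, k)) :
    (forall a j, U a j = c j * V a j) ->
  cross (U : 'M_(k.+1, k.+1.-1))
    = \prod_j c j *: cross (V : 'M_(k.+1, k.+1.-1)).
Proof.
move=> UV; apply/colP => a; rewrite !mxE.
pose d b := if unlift ord_max b is Some j then c j else 1.
rewrite (det_scale_cols (c := d) (B := bordered V (delta_mx a 0))).
  congr (_ * _); rewrite big_ord_recr /= {2}/d unlift_none mulr1.
  apply: eq_bigr => j _; rewrite /d.
  have -> : widen_ord (leqnSn k) j = lift ord_max j.
    by apply: val_inj; rewrite /= /bump leqNgt ltn_ord.
  by rewrite liftK.
by move=> x b; rewrite !borderedS /d; case: unliftP => [j _|_]; rewrite ?mul1r.
Qed.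

End Sequences.

(** The double cross product is parallel to P (s + k), the only vector which
    occurs in all the inner cross products.  To find the factor, pair both sides
    with a vector y and multiply (w_0, ..., w_k, y)^T, where w_j is the j-th
    inner cross product, by the window B at s + k: in the first column only the
    pairing of y with P (s + k) can be nonzero, and its complementary minor is
    triangular with diagonal D s, ..., D (s + k). *)
Lemma cross_cross (F : fieldType) k (P : nat -> 'cV[F]_k.+2) s :
  let D t := \det (window k.+2 t P) in
  D (s + k)%N *:
    cross (\matrix_(a < k.+2, j < k.+2.-1)
      cross (window k.+2.-1 (s + j) P) a 0) =
  ((-1) ^+ k.+1 * \prod_(j < k.+1) D (s + j)%N) *: P (s + k)%N.
Proof.
move=> D; apply/colP => a; rewrite [LHS]mxE [RHS]mxE.
rewrite [X in _ * X]mxE; set W := (X in bordered X _).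
set B := window k.+2 (s + k) P.
set y := delta_mx a 0.
pose M := (bordered (W : 'M_(k.+2, k.+1)) y)^T *m B.
have ME (j : 'I_k.+1) l : M (lift ord_max j) l =
    \det (bordered (window k.+1 (s + j) P) (P (s + k + l)%N)).
  transitivity (((cross (window k.+2.-1 (s + j) P))^T *m P (s + k + l)%N) 0 0).
    by rewrite !mxE; apply: eq_bigr => b _; rewrite mxE bordered_lift !mxE.
  by rewrite crossP // mxE eqxx mulr1n.
have M0 (j : 'I_k.+1) (l : 'I_k.+2) : (l <= j)%N -> M (lift ord_max j) l = 0.
  move=> lj; rewrite ME; have := ltn_ord j => jk.
  have -> : (s + k + l = s + j + (k + l - j))%N by lia.
  by apply: det_bordered_window_eq0; lia.
have Mm : M ord_max ord0 = P (s + k)%N a 0.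
  rewrite mxE (bigD1 a) //= big1 => [|b ba].
    by rewrite mxE bordered_max !mxE !eqxx mul1r addn0 addr0.
  by rewrite mxE bordered_max mxE (negPf ba) mul0r.
rewrite /D mulrC -[X in X * _]det_tr -det_mulmx -/M (expand_det_col _ ord0).
rewrite (bigD1 ord_max) //= big1 ?addr0 => [|b]; last first.
  by case: (unliftP ord_max b) => [j ->|-> /eqP//] _; rewrite M0 ?mul0r.
rewrite Mm mulrC /cofactor /= addn0; congr (_ * _ * _).
(* N is the transpose of the minor, which makes it lower triangular. *)
rewrite -det_tr; set N := (X in \det X).
have NE (i j : 'I_k.+1) : N i j = M (lift ord_max j) (lift ord0 i).
  by rewrite 3!mxE.
rewrite det_trig => [|].
  apply: eq_bigr => j _; rewrite NE ME lift0 -det_bordered_window.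
  by congr (\det (bordered _ (P _))); lia.
by apply/is_trig_mxP => i j ij; rewrite NE M0 // lift0.
Qed.

(** * Increasing enumerations of subsets *)

Lemma increasing_image_inj m l (f g : 'I_m -> 'I_l) :
    {homo f : i j / (i < j)%N} -> {homo g : i j / (i < j)%N} ->
    codom f =i codom g ->
  f =1 g.
Proof.
have sorted_codom (h : 'I_m -> 'I_l) : {homo h : i j / (i < j)%N} ->
    sorted (fun x y : 'I_l => (x < y)%N) (codom h).
  move=> h_lt; rewrite sorted_map.
  apply: (@sub_sorted _ (fun x y : 'I_m => (x < y)%N)); first exact: h_lt.
  have : sorted ltn (map val (enum 'I_m)).
    by rewrite val_enum_ord iota_ltn_sorted.
  by rewrite sorted_map.
move=> f_lt g_lt fg j; have ltT : transitive (fun x y : 'I_l => (x < y)%N).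
  by move=> y x z; apply: ltn_trans.
have/eq_in_map -> // := irr_sorted_eq ltT (fun x : 'I_l => ltnn x)
  (sorted_codom f f_lt) (sorted_codom g g_lt) fg.
by rewrite mem_enum.
Qed.

Lemma increasing_inj m l (f : 'I_m -> 'I_l) :
  {homo f : i j / (i < j)%N} -> injective f.
Proof.
move=> f_lt x y fxy; apply: val_inj.
by case: (ltngtP x y) => // /f_lt; rewrite fxy ltnn.
Qed.

Lemma ksub_col_unique k n (I : k_subset k n) (c : 'I_k -> 'I_n) :
    (forall j, c j \in sval I) -> {homo c : i j / (i < j)%N} ->
  ksub_col I =1 c.
Proof.
have codom_full (f : 'I_k -> 'I_n) : (forall j, f j \in sval I) ->
    {homo f : i j / (i < j)%N} -> codom f =i sval I.
  move=> fI f_lt; apply/subset_cardP.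
    by rewrite card_codom ?card_ord ?(eqP (valP I)) //; apply: increasing_inj.
  by apply/subsetP => _ /codomP[j ->].
move=> cI c_lt; have ks_lt := @ksub_col_lt k n I.
apply: increasing_image_inj => // x.
rewrite !codom_full // => j; exact: enum_valP.
Qed.

(** * The signed cyclic extension of a matrix *)

Section Cyclic.
Variables (F : fieldType) (k n : nat).
Implicit Type p : 'M[F]_(k.+1, n.+1).

(** The sign makes both the twist and the frozen minors free of signs. *)
Definition cyclic_col p i : 'cV[F]_k.+1 :=
  (-1) ^+ (k * (i %/ n.+1)) *: col (inZp i) p.

Lemma cyclic_col_quasi_periodic p : quasi_periodic n.+1 (cyclic_col p).
Proof.
move=> i; rewrite /cyclic_col divnDr // divnn addn1 mulnS exprD -scalerA.
by congr (_ *: (_ *: col _ p)); apply: val_inj; rewrite /= modnDr.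
Qed.

Lemma cyclic_col_ord p (i : 'I_n.+1) : cyclic_col p i = col i p.
Proof.
rewrite /cyclic_col divn_small // muln0 scale1r; congr (col _ p).
by apply: val_inj; rewrite /= modn_small.
Qed.

End Cyclic.

Section CyclicTheory.
Variables (F : fieldType) (k n : nat).
Implicit Type p : 'M[F]_(k.+1, n.+1).

Lemma sum_ltn_ord m d : (d <= m)%N -> (\sum_(j < m) (j < d) = d)%N.
Proof.
move=> dm; rewrite -[RHS]card_ord -sum1_card (big_ord_widen _ (fun=> 1%N) dm).
by rewrite [RHS]big_mkcond; apply: eq_bigr => j _; case: ltnP.
Qed.

(** In [cyclic_col_twist], q r are the quotient and remainder of the last index
    of a window, and S is the sum of the quotients of the k others: the
    exponents of (-1)^k collected on both sides differ by [twist_sign]. *)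
Lemma odd_twist_sign (q r S : nat) : (S + (k - r) = k * q)%N -> (r <= k)%N ->
  odd (k * S) = odd (k * q + r.+1 * (k - r)).
Proof.
move=> SE rk; have := congr1 odd SE; rewrite !(oddD, oddM) oddB //=.
by case: (odd S); case: (odd k); case: (odd r); case: (odd q).
Qed.

(** [twist_sign] is (-1)^k raised to the number of factors of the cross product
    whose index, divided by n.+1, has a smaller quotient than s + k. *)
Lemma cyclic_col_twist p s : (k <= n)%N ->
  cyclic_col (twist_mx p) (s + k) = cross (window k.+1.-1 s (cyclic_col p)).
Proof.
move=> kn.
have [q [r [rn iE]]] : exists q r, (r < n.+1)%N /\ (s + k = q * n.+1 + r)%N.
  exists ((s + k) %/ n.+1)%N, ((s + k) %% n.+1)%N.
  by rewrite ltn_mod -divn_eq.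
pose r' : 'I_n.+1 := inZp (s + k).
have r'E : r' = r :> nat by rewrite /= iE modnMDl modn_small.
(* Dividing s + j by n.+1 gives a smaller quotient than s + k iff j < k - r. *)
have Q (j : 'I_k) : ((s + j) %/ n.+1 = q - (j < k - r))%N /\
   ((s + j) %% n.+1 = (r + (n.+1 - (k - j))) %% n.+1)%N.
  have jk := ltn_ord j; have [jr|jr] := ltnP j (k - r).
    case: q iE => [|q] iE; first by lia.
    have -> : (s + j = q * n.+1 + (r + (n.+1 - (k - j))))%N.
      by rewrite mulSn in iE; lia.
    rewrite divnMDl // modnMDl subn1; split => //=.
    by rewrite divn_small ?addn0 //; lia.
  have -> : (s + j = q * n.+1 + (r - (k - j)))%N by lia.
  rewrite divnMDl // modnMDl divn_small; last by lia.
  rewrite addn0 subn0; split => //.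
  have -> : (r + (n.+1 - (k - j)) = r - (k - j) + n.+1)%N by lia.
  by rewrite modnDr.
rewrite (cross_scale_cols
  (c := fun j : 'I_k => (-1) ^+ (k * (q - (j < k - r)))%N)
  (V := twist_cols p r')); last first.
  move=> a j; rewrite !mxE; have [-> Qm] := Q j; congr (_ * p a _).
  apply: ord_inj; rewrite iter_ord_predE ?r'E; first exact: Qm.
  by have := ltn_ord j; lia.
apply/colP => a; rewrite /cyclic_col !mxE mulrA -/r' iE divnMDl //.
rewrite divn_small // addn0; congr (_ * _); rewrite prodrXr -big_distrr /=.
set S := (\sum_(j < k) _)%N.
have SE : (S + (k - r) = k * q)%N.
  rewrite -[(k - r)%N in LHS](sum_ltn_ord (leq_subr r k)) -big_split /=.
  rewrite -[k in RHS]card_ord -sum_nat_const; apply: eq_bigr => j _.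
  by have := ltn_ord j; case: ltnP => //=; nia.
rewrite /twist_sign r'E !ltnS subSS.
have [rk|kr] := leqP k r.
  have -> : S = (k * q)%N by rewrite -SE; lia.
  by rewrite mulr1 -signr_odd -[RHS]signr_odd !oddM; case: (odd k).
by rewrite -exprD -signr_odd -(odd_twist_sign SE) ?signr_odd ?(ltnW kr).
Qed.

(** The increasing enumeration of a frozen set is a rotation of the cyclic
    interval.  Extend the columns it selects to a sequence u of signed period
    k.+1: the window of [cyclic_col p] is a window of u, which has the same
    minor as the window of u at 0 by [det_window_shift]. *)
Lemma plucker_frozen (kn : (k.+1 <= n.+1)%N) p s :
  plucker_fun (frozen kn (inZp (s + k))) p
    = \det (window k.+1 s (cyclic_col p)).
Proof.
set q := (s %/ n.+1)%N; set r := (s %% n.+1)%N.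
have rn : (r < n.+1)%N by rewrite ltn_mod.
have sE : (s = q * n.+1 + r)%N by rewrite -divn_eq.
have -> : inZp (s + k) = inZp (r + k) :> 'I_n.+1.
  by apply: val_inj; rewrite /= modnDml.
rewrite (det_scale_cols (c := fun=> (-1) ^+ (k * q))
  (B := window k.+1 r (cyclic_col p))); last first.
  move=> a j; rewrite mxE {1}sE -addnA addnC.
  by rewrite (quasi_periodic_mul _ _ (cyclic_col_quasi_periodic p)) !mxE.
rewrite prodr_const card_ord -exprM mulnAC exprM signr_mul_pred expr1n mul1r.
(* m is the number of columns of the window after the wrap-around; they come
   first in the increasing enumeration c. *)
pose m := (r + k - n)%N.
pose d j := (if j < m then j else r - m + j)%N.
pose c (j : 'I_k.+1) : 'I_n.+1 := inZp (d j).
have cE (j : 'I_k.+1) : c j = d j :> nat.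
  by rewrite /= modn_small //; have := ltn_ord j; rewrite /d /m; case: ifP; lia.
have -> : plucker_fun (frozen kn (inZp (r + k))) p = \det (colsub c p).
  congr (\det _); apply/matrixP => a j; rewrite !mxE; congr (p a _).
  apply: ksub_col_unique => {a} {}j => [|j' jj']; last first.
    by rewrite !cE /d /m; have := ltn_ord j'; do 2 case: ifP; lia.
  have jk := ltn_ord j.
  (* c j is the e-th cyclic predecessor of the last column of the window. *)
  pose e := (if (j < m)%N then m.-1 - j else k - (j - m))%N.
  have ek : (e < k.+1)%N by rewrite /e /m; case: ifP; lia.
  apply/imsetP; exists (Ordinal ek) => //; apply: ord_inj.
  rewrite iter_ord_predE /=; last by lia.
  rewrite modnDml /d /e; case: ifP => jm.
    have -> : (r + k + (n.+1 - (m.-1 - j)) = j + n.+1 + n.+1)%N.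
      by rewrite /m in jm *; lia.
    by rewrite !modnDr.
  have -> : (r + k + (n.+1 - (k - (j - m))) = r - m + j + n.+1)%N.
    by rewrite /m in jm *; lia.
  by rewrite modnDr.
set u := cyclic_col (colsub c p).
have u_per : quasi_periodic k.+1 u by apply: cyclic_col_quasi_periodic.
have -> : colsub c p = window k.+1 0 u.
  by apply/matrixP => a j; rewrite [RHS]mxE add0n /u cyclic_col_ord !mxE.
rewrite -(det_window_shift m u_per); congr (\det _); apply/matrixP => a j.
have jk := ltn_ord j; rewrite [LHS]mxE [RHS]mxE.
have [mj|mj] := ltnP (m + j) k.+1.
  have -> : u (m + j)%N = col (Ordinal mj) (colsub c p).
    exact: (cyclic_col_ord _ (Ordinal mj)).
  have rj : (r + j < n.+1)%N by rewrite /m in mj *; lia.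
  rewrite (cyclic_col_ord p (Ordinal rj)) !mxE; congr (p a _).
  by apply: ord_inj; rewrite cE /d /=; case: ifP; rewrite /m; lia.
have jm : (m + j - k.+1 < k.+1)%N by rewrite /m in mj *; lia.
have rj : (r + j - n.+1 < n.+1)%N by lia.
have -> : (m + j = m + j - k.+1 + k.+1)%N by lia.
have -> : (r + j = r + j - n.+1 + n.+1)%N by rewrite /m in mj; lia.
rewrite u_per cyclic_col_quasi_periodic /u (cyclic_col_ord _ (Ordinal jm)).
rewrite (cyclic_col_ord p (Ordinal rj)) !mxE; congr (_ * p a _).
by apply: ord_inj; rewrite cE /d /=; case: ifP; rewrite /m; lia.
Qed.

End CyclicTheory.

(** * The double twist where no frozen coordinate vanishes *)

Section DoubleTwist.
Variables (F : fieldType) (k n : nat) (kn : (k.+2 <= n.+1)%N).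
Implicit Types (p : 'M[F]_(k.+2, n.+1)) (f g : 'M[F]_(k.+2, n.+1) -> F).

Definition generic p := forall i, plucker_fun (frozen kn i) p != 0.

Definition minor_from p s := \det (window k.+2 s (cyclic_col p)).

Definition double_twist p := twist_mx (twist_mx p).

(** The product over the cyclic intervals of length k.+2 that contain t but
    neither start nor end there.  They start at t - k + j for j < k; adding n.+1
    keeps the indices nonnegative and does not change the minors. *)
Definition scalar_from p t :=
  \prod_(j < k) minor_from p (t + n.+1 - k + j).

Lemma minor_from_neq0 p s : generic p -> minor_from p s != 0.
Proof. by move=> p_gen; rewrite /minor_from -(plucker_frozen kn). Qed.

(** Apply [cross_cross] where the distinguished vector is the one at t + n.+1 and
    cancel the minor there; both sides carry the sign of one period. *)
Lemma cyclic_col_double_twist p t : generic p ->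
  cyclic_col (double_twist p) (t + k.+2)
    = ((-1) ^+ k.+1 * scalar_from p t) *: cyclic_col p t.
Proof.
move=> p_gen; set s := (t + n.+1 - k)%N.
have sk : (s + k = t + n.+1)%N by rewrite /s; lia.
pose X := cross
  (\matrix_(a < k.+2, j < k.+2.-1)
    cross (window k.+2.-1 (s + j) (cyclic_col p)) a 0).
have : minor_from p (s + k) *: X =
    ((-1) ^+ k.+1 * \prod_(j < k.+1) minor_from p (s + j))
      *: cyclic_col p (s + k).
  exact: cross_cross.
have <- : (-1) ^+ k.+1 *: cyclic_col (double_twist p) (t + k.+2) = X.
  rewrite -cyclic_col_quasi_periodic.
  have -> : (t + k.+2 + n.+1 = s + k.+1 + k.+1)%N by lia.
  rewrite cyclic_col_twist; last by lia.
  congr cross; apply/matrixP => a j; rewrite [LHS]mxE [RHS]mxE.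
  by rewrite addnAC cyclic_col_twist //; lia.
rewrite sk big_ord_recr /= sk cyclic_col_quasi_periodic -/(scalar_from p t).
have D0 := minor_from_neq0 (t + n.+1) p_gen.
have e0 : minor_from p (t + n.+1) * (-1) ^+ k.+1 != 0.
  by rewrite mulf_neq0 ?signr_eq0.
move=> E; apply: (scalerI e0).
by rewrite -[LHS]scalerA E !scalerA; congr (_ *: _); ring.
Qed.

Lemma minor_from_double_twist p s : generic p ->
  minor_from (double_twist p) (s + k.+2)
    = \prod_(l < k.+2) scalar_from p (s + l) * minor_from p s.
Proof.
move=> p_gen; rewrite /minor_from (det_scale_cols
  (c := fun l : 'I_k.+2 => (-1) ^+ k.+1 * scalar_from p (s + l))
  (B := window k.+2 s (cyclic_col p))); last first.
  move=> a l; rewrite mxE addnAC cyclic_col_double_twist // mxE.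
  by rewrite [in RHS]mxE.
by rewrite big_split /= prodr_const card_ord -exprM signr_mul_pred mul1r.
Qed.

(** Any multiple of n.+1 may be added to the starting point of the interval that
    ends at i; 2 (n.+1) leaves room for subtracting k.+1 and k.+2, so that
    [minor_from_double_twist] applies. *)
Lemma frozen_minor_from (i : 'I_n.+1) :
  exists s, forall p, plucker_fun (frozen kn i) p = minor_from p (s + k.+2).
Proof.
exists (i + (n.+1.*2 - (k.+1 + k.+2)))%N => p.
rewrite /minor_from -(plucker_frozen kn); congr (plucker_fun (frozen kn _) p).
have -> : (i + (n.+1.*2 - (k.+1 + k.+2)) + k.+2 + k.+1
    = i + n.+1 + n.+1)%N by lia.
by apply: ord_inj; rewrite /= !modnDr modn_small.
Qed.

Lemma generic_double_twist p : generic p -> generic (double_twist p).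
Proof.
move=> p_gen i; have [s ->] := frozen_minor_from i.
rewrite minor_from_double_twist // mulf_neq0 ?minor_from_neq0 //.
by apply/prodf_neq0 => l _; apply/prodf_neq0 => j _; apply: minor_from_neq0.
Qed.

(** Only generic matrices are considered, because the formula for the double
    twist comes from cancelling a frozen coordinate. *)
Definition frozen_monomial f := exists a : 'I_n.+1 -> nat,
  forall p, generic p -> f p = \prod_i plucker_fun (frozen kn i) p ^+ a i.

Lemma eq_frozen_monomial f g :
  (forall p, generic p -> f p = g p) -> frozen_monomial g -> frozen_monomial f.
Proof. by move=> fg [a ga]; exists a => p p_gen; rewrite fg // ga. Qed.

Lemma frozen_monomial1 : frozen_monomial (fun=> 1).
Proof. by exists (fun=> 0%N) => p _; rewrite big1 // => i _; rewrite expr0. Qed.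

Lemma frozen_monomialM f g :
  frozen_monomial f -> frozen_monomial g ->
  frozen_monomial (fun p => f p * g p).
Proof.
move=> [a fa] [b gb]; exists (fun i => a i + b i)%N => p p_gen.
by rewrite fa // gb // -big_split; apply: eq_bigr => i _; rewrite exprD.
Qed.

Lemma frozen_monomial_prod (J : Type) (r : seq J) h :
    (forall j, frozen_monomial (h j)) ->
  frozen_monomial (fun p => \prod_(j <- r) h j p).
Proof.
move=> hm; elim: r => [|j r IHr].
  by apply: eq_frozen_monomial frozen_monomial1 => p _; rewrite big_nil.
apply: eq_frozen_monomial (frozen_monomialM (hm j) IHr) => p _.
by rewrite big_cons.
Qed.

Lemma frozen_monomialX f m :
  frozen_monomial f -> frozen_monomial (fun p => f p ^+ m).
Proof.
move=> fm.
apply: eq_frozen_monomial (frozen_monomial_prod (index_enum 'I_m) (fun=> fm)).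
by move=> p _; rewrite prodr_const card_ord.
Qed.

Lemma frozen_monomial_minor_from s : frozen_monomial (minor_from ^~ s).
Proof.
exists (fun i => i == inZp (s + k.+1))%N => p _.
rewrite (bigD1 (inZp (s + k.+1))) //= eqxx expr1 plucker_frozen big1 ?mulr1 //.
by move=> i /negPf ->; rewrite expr0.
Qed.

Lemma frozen_monomial_scalar_from t : frozen_monomial (scalar_from ^~ t).
Proof.
by apply: frozen_monomial_prod => j; apply: frozen_monomial_minor_from.
Qed.

Lemma frozen_monomial_double_twist f :
  frozen_monomial f -> frozen_monomial (f \o double_twist).
Proof.
move=> [a fa]; apply: (@eq_frozen_monomial _ (fun p =>
  \prod_i plucker_fun (frozen kn i) (double_twist p) ^+ a i)).
  by move=> p p_gen; rewrite /= fa //; apply: generic_double_twist.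
apply: frozen_monomial_prod => i; apply: frozen_monomialX.
have [s sP] := frozen_minor_from i.
apply: (@eq_frozen_monomial _ (fun p =>
  \prod_(l < k.+2) scalar_from p (s + l) * minor_from p s)).
  by move=> p p_gen; rewrite sP minor_from_double_twist.
apply: frozen_monomialM (frozen_monomial_minor_from s).
by apply: frozen_monomial_prod => l; apply: frozen_monomial_scalar_from.
Qed.

(** Each double twist moves a column by k.+2 positions.  Peeling off the first
    of them, rather than the last, means that a monomial already known is
    composed with one double twist only. *)
Lemma cyclic_col_iter_double_twist m i :
  exists2 f, frozen_monomial f & forall p, generic p ->
    cyclic_col (iter m double_twist p) (i + m * k.+2)
      = ((-1) ^+ (k.+1 * m) * f p) *: cyclic_col p i.
Proof.
elim: m i => [|m IHm] i.
  exists (fun=> 1); first exact: frozen_monomial1.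
  by move=> p _; rewrite mul0n muln0 addn0 mulr1 scale1r.
have [f fm fP] := IHm (i + k.+2)%N.
exists (fun p => f (double_twist p) * scalar_from p i).
  apply: frozen_monomialM (frozen_monomial_scalar_from i).
  exact: frozen_monomial_double_twist.
move=> p p_gen; rewrite iterSr mulSn addnA fP; last exact: generic_double_twist.
rewrite cyclic_col_double_twist // scalerA mulnS exprD.
by congr (_ *: _); ring.
Qed.

(** After n.+1 double twists the shift is a multiple of n.+1, so each column
    returns to its place up to a scalar. *)
Lemma plucker_iter_double_twist I :
  exists2 f, frozen_monomial f & forall p, generic p ->
    plucker_fun I (iter n.+1 double_twist p) = plucker_fun I p * f p.
Proof.
have /choice[f fP] (j : 'I_k.+2) : exists f, frozen_monomial f /\
    forall p, generic p -> col (ksub_col I j) (iter n.+1 double_twist p)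
      = ((-1) ^+ (k.+1 * n.+1) * f p) *: col (ksub_col I j) p.
  have [f fm fP] := cyclic_col_iter_double_twist n.+1 (ksub_col I j).
  exists f; split=> // p /fP; rewrite mulnC.
  rewrite (quasi_periodic_mul _ _ (cyclic_col_quasi_periodic _)).
  by rewrite signr_mul_pred scale1r !cyclic_col_ord.
exists (fun p => \prod_j f j p).
  by apply: frozen_monomial_prod => j; case: (fP j).
move=> p p_gen; rewrite mulrC /plucker_fun (det_scale_cols
  (c := fun j => (-1) ^+ (k.+1 * n.+1) * f j p)
  (B := colsub (ksub_col I) p)); last first.
  move=> a j; have [_ /(_ p p_gen) /colP /(_ a)] := fP j.
  by rewrite !mxE => ->.
rewrite big_split /= prodr_const card_ord -exprM mulnAC exprM.
by rewrite signr_mul_pred expr1n mul1r.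
Qed.

End DoubleTwist.

(** * Density of the nonvanishing locus *)

Section Density.
Variables (F : numFieldType) (k n : nat).
Implicit Types f g h : 'M[F]_(k, n) -> F.

Lemma in_Gr_line f p q : in_Gr f ->
  exists P : {poly F}, forall t, f (p + t *: q) = P.[t].
Proof.
elim=> {f} [I|c|f g _ [P fP] _ [Q gQ]|f g _ [P fP] _ [Q gQ]].
- pose A : 'M[{poly F}]_k :=
    colsub (ksub_col I) (map_mx polyC p + 'X *: map_mx polyC q).
  exists (\det A) => t; rewrite -[RHS]/(horner_eval t _) -det_map_mx.
  congr (\det _); apply/matrixP => a j; rewrite !mxE.
  by rewrite -[RHS]/(horner _ t) !hornerE.
- by exists c%:P => t; rewrite hornerC.
- by exists (P + Q) => t; rewrite hornerD fP gQ.
- by exists (P * Q) => t; rewrite hornerM fP gQ.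
Qed.

Lemma poly_vanishing (P : {poly F}) : (forall t, P.[t] = 0) -> P = 0.
Proof.
move=> P0; apply: (@roots_geq_poly_eq0 _ _ [seq i%:R | i <- iota 0 (size P)]).
- by apply/allP => x _; apply/rootP.
- rewrite map_inj_uniq ?iota_uniq // => i j /eqP.
  by rewrite Num.Theory.eqr_nat => /eqP.
- by rewrite size_map size_iota.
Qed.

(** On the line through p and q, the product of f - g and h vanishes while h
    does not vanish identically; polynomials in one variable over an infinite
    field form a domain of functions. *)
Lemma in_Gr_dense f g h q : in_Gr f -> in_Gr g -> in_Gr h -> h q != 0 ->
  (forall p, h p != 0 -> f p = g p) -> f =1 g.
Proof.
move=> fG gG hG hq0 fg p.
have [P fP] := in_Gr_line p (q - p) fG.
have [Q gQ] := in_Gr_line p (q - p) gG.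
have [R hR] := in_Gr_line p (q - p) hG.
have /poly_vanishing /eqP : forall t, ((P - Q) * R).[t] = 0.
  move=> t; rewrite hornerM hornerD hornerN -fP -gQ -hR.
  have [->|/fg ->] := eqVneq (h (p + t *: (q - p))) 0; first by rewrite mulr0.
  by rewrite subrr mul0r.
rewrite mulf_eq0 => /orP[|/eqP R0].
  by rewrite subr_eq0 => /eqP PQ; have := fP 0; rewrite PQ -gQ scale0r addr0.
have := hR 1; rewrite scale1r subrKC R0 horner0 => hq.
by rewrite hq eqxx in hq0.
Qed.

(** The Vandermonde matrix with nodes 0, ..., n - 1: its maximal minors are
    Vandermonde determinants with distinct nodes. *)
Lemma exists_plucker_neq0 :
  exists p : 'M[F]_(k, n), forall I, plucker_fun I p != 0.
Proof.
exists (Vandermonde k (\row_i (i : nat)%:R)) => I.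
rewrite /plucker_fun.
have -> : colsub (ksub_col I) (Vandermonde k (\row_i (i : nat)%:R)) =
    Vandermonde k (\row_j (ksub_col I j : nat)%:R) :> 'M[F]_k.
  by apply/matrixP => a j; rewrite !mxE.
rewrite det_Vandermonde; apply/prodf_neq0 => i _; apply/prodf_neq0 => j ij.
rewrite !mxE subr_eq0 Num.Theory.eqr_nat.
by have := ksub_col_lt I ij; lia.
Qed.

End Density.

(** * Back to the coordinate ring *)

Lemma twist_iter (F : fieldType) k n m (f : Gr_ring F k n) p :
  iter m (@twist F k n) f p = f (iter m (@twist_mx F k n) p).
Proof. by elim: m p => // m IHm p; rewrite iterS iterSr -IHm. Qed.

Lemma Gr_funX (F : fieldType) k n (f : Gr_ring F k n) m p :
  (f ^+ m) p = f p ^+ m.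
Proof. by elim: m => // m IHm; rewrite !exprS -IHm. Qed.

Lemma Gr_fun_prod (F : fieldType) k n (J : Type) (r : seq J)
    (f : J -> Gr_ring F k n) p :
  (\prod_(j <- r) f j) p = \prod_(j <- r) f j p.
Proof. by elim: r => [|j r IHr]; rewrite ?big_nil ?big_cons //= -IHr. Qed.

Local Open Scope complex_scope.

Theorem proposition4p3 (R : realType) (k n : nat)
    (hk : (1 < k)%N) (hkn : (k <= n)%N) (I : k_subset k n) :
  exists a : 'I_n -> nat,
    iter (2 * n) (@twist R[i] k n) (plucker R[i] I)
    = plucker R[i] I * \prod_(i < n) plucker R[i] (frozen hkn i) ^+ a i.
Proof.
case: k n hk hkn I => [|[|k]] // [|n] // _ kn I.
have [f [a fa] fP] := plucker_iter_double_twist R[i] kn I.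
exists a; apply: val_inj; apply/funext.
pose h := \prod_(i < n.+1) plucker R[i] (frozen kn i).
have inG (g : Gr_ring R[i] k.+2 n.+1) : in_Gr g by apply/Gr_predP/Gr_funP.
have [q q_gen] := exists_plucker_neq0 R[i] k.+2 n.+1.
apply: (in_Gr_dense (q := q) (inG _) (inG _) (inG h)).
  by rewrite Gr_fun_prod; apply/prodf_neq0 => i _; apply: q_gen.
move=> p; rewrite Gr_fun_prod => /prodf_neq0 p_gen.
have {}p_gen : generic kn p by move=> i; apply: p_gen.
rewrite twist_iter mulnC iterM /= -/(double_twist _).
transitivity (plucker_fun I p * f p); first exact: fP.
rewrite fa //; congr (_ * _); rewrite Gr_fun_prod.
by apply: eq_bigr => i _; rewrite Gr_funX.
Qed.
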